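(* Let $n\ge 1$, let $\lambda$ be an $n$-partition, let $\pi\in S_n$, and let $T\in\mathcal{T}_\lambda$. Then $S(T)\le Y_\lambda(\pi)$ if and only if $T(l,k)\in A_\lambda(T,\pi;l,k)$ for all $(l,k)\in\lambda$.
   Context: Notation. Fix $n\ge 1$. For integers $p,q$, $[p,q]=\{p,p+1,\dots,q\}$ (empty if $p>q$). An $n$-partition is $\lambda=(\lambda_1\ge\dots\ge\lambda_n\ge 0)$, integers. Its shape has $\lambda_i$ left-justified boxes in row $i$ (row 1 at the top). The box in column $j$ and row $i$ is written $(j,i)\in\lambda$ (column index first). The column lengths are $\zeta_1,\dots,\zeta_{\lambda_1}$. A semistandard tableau $T$ of shape $\lambda$ is a filling with values $T(j,i)\in[1,n]$ such that $T(j,i)\le T(j+1,i)$ and $T(j,i)<T(j,i+1)$; $\mathcal{T}_\lambda$ is the set of these. Boundary conventions: $T(l+1,k):=n$ if $l=\lambda_k$; $T(l,k+1):=n+1$ if $k=\zeta_l$. For tableaux of the same shape, $T\le U$ means $T(j,i)\le U(j,i)$ for all boxes. $m(T)$ is the maximum of the values at the bottoms of the columns of $T$ (equivalently the maximum value of $T$); for the empty tableau, $m:=1$. Keys. $S_n$ is the set of $n$-tuples $\pi=(\pi_1,\dots,\pi_n)$ with distinct entries from $[1,n]$. The $\lambda$-key $Y=Y_\lambda(\pi)$ is the tableau of shape $\lambda$ whose $j$th column consists of $\pi_1,\dots,\pi_{\zeta_j}$ sorted increasingly from top to bottom, with entries $Y(j,i)$. Scanning tableau. The earliest weakly increasing subsequence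 (EWIS) of a sequence $(x_1,x_2,\dots)$ is $(x_{i_1},x_{i_2},\dots)$ with $i_1=1$ and, for $j>1$, $i_j$ minimal with $i_j>i_{j-1}$ and $x_{i_{j-1}}\le x_{i_j}$. For $1\le l\le\lambda_1$, let $T^{(l,\zeta_l)}$ be $T$ with its first $l-1$ columns removed (column indexing retained). For $k=\zeta_l,\zeta_l-1,\dots,1$: read the bottom values of the nonempty columns of $T^{(l,k)}$ from left to right (starting with column $l$, whose bottom is at $(l,k)$), take the EWIS of this sequence, let the scanning path $P(T;l,k)$ be the sequence of locations of this EWIS, and let $S(T;l,k)$ be the last value of this EWIS; then let $T^{(l,k-1)}$ be the (semistandard) tableau obtained from $T^{(l,k)}$ by removing the boxes of $P(T;l,k)$. The scanning tableau $S(T)$ is the filling of $\lambda$ with value $S(T;l,k)$ at $(l,k)$. Let $U^{(l,k)}$ be $T^{(l,k)}$ with its leftmost remaining column (column $l$) removed. The sets $A$. Write $U=U^{(l,k)}$. If $m(U)>Y(l,k)$, then $A_\lambda(T,\pi;l,k):=\emptyset$. If $m(U)\le Y(l,k)$, then $A_\lambda(T,\pi;l,k):=[k,\min\{Y(l,k),\,T(l,k+1)-1,\,T(l+1,k)\}]$. *)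

(* Defs.v *)
From mathcomp Require Import all_boot.

Set Implicit Arguments.
Unset Strict Implicit.
Unset Printing Implicit Defensive.

(* Rows, columns and the entries of tuples are numbered from 1, and a box is
   written with its column index first: (j, i) is in column j and row i. *)

Definition partition_tuple (n : nat) (lam : n.-tuple nat) : bool :=
  sorted geq lam.

Definition row_len (n : nat) (lam : n.-tuple nat) (i : nat) : nat :=
  nth 0 lam i.-1.

Definition col_len (n : nat) (lam : n.-tuple nat) (j : nat) : nat :=
  count (fun r => j <= r) lam.

Definition in_shape (n : nat) (lam : n.-tuple nat) (j i : nat) : bool :=
  (1 <= i <= n) && (1 <= j <= row_len lam i).

(* T j i is the value at the box (j, i); values outside the shape are
   irrelevant, and no definition below depends on them. *)
Definition filling := nat -> nat -> nat.

Definition semistandard (n : nat) (lam : n.-tuple nat) (T : filling) : Prop :=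
  forall j i, in_shape lam j i ->
    [/\ 1 <= T j i <= n,
        in_shape lam j.+1 i -> T j i <= T j.+1 i
      & in_shape lam j i.+1 -> T j i < T j i.+1].

Definition right_value (n : nat) (lam : n.-tuple nat) (T : filling)
    (l k : nat) : nat :=
  if l == row_len lam k then n else T l.+1 k.

Definition below_value (n : nat) (lam : n.-tuple nat) (T : filling)
    (l k : nat) : nat :=
  if k == col_len lam l then n.+1 else T l k.+1.

Definition filling_le (n : nat) (lam : n.-tuple nat) (T U : filling) : Prop :=
  forall j i, in_shape lam j i -> T j i <= U j i.

Definition perm_tuple (n : nat) (pi : n.-tuple nat) : bool :=
  uniq pi && all (fun x => 1 <= x <= n) pi.

Definition key (n : nat) (lam : n.-tuple nat) (pi : n.-tuple nat) : filling :=
  fun j i => nth 0 (sort leq (take (col_len lam j) pi)) i.-1.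

(* The earliest weakly increasing subsequence of the values f x, for x in s,
   given by the members of s at which it is taken. ewis_from v s is the part
   taken from s once the last value taken is v. *)
Fixpoint ewis_from (A : Type) (f : A -> nat) (v : nat) (s : seq A) : seq A :=
  if s is x :: s' then
    if v <= f x then x :: ewis_from f (f x) s' else ewis_from f v s'
  else [::].

Definition ewis (A : Type) (f : A -> nat) (s : seq A) : seq A :=
  if s is x :: s' then x :: ewis_from f (f x) s' else [::].

Definition value_at (T : filling) (b : nat * nat) : nat := T b.1 b.2.

(* The tableaux that occur while scanning T are restrictions of T, each to a
   set of boxes made of the top c j boxes of column j for every j. Such a
   tableau is represented by its column lengths c : nat -> nat. *)

Definition bottoms (n : nat) (lam : n.-tuple nat) (c : nat -> nat) :
    seq (nat * nat) :=
  [seq (j, c j) | j <- iota 1 (row_len lam 1) & 0 < c j].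

Definition scan_path (n : nat) (lam : n.-tuple nat) (T : filling)
    (c : nat -> nat) : seq (nat * nat) :=
  ewis (value_at T) (bottoms lam c).

(* All boxes of a scanning path are column bottoms, so removing them shortens
   by one the columns whose bottom is on the path. *)
Definition remove_path (n : nat) (lam : n.-tuple nat) (T : filling)
    (c : nat -> nat) : nat -> nat :=
  fun j => if (j, c j) \in scan_path lam T c then (c j).-1 else c j.

(* The columns left of l are dropped, and the paths found from the boxes of
   column l strictly below (l, k) are then removed, lowest box first, so that
   column l keeps its top k boxes. *)
Definition scan_cols (n : nat) (lam : n.-tuple nat) (T : filling)
    (l k : nat) : nat -> nat :=
  iter (col_len lam l - k) (remove_path lam T)
    (fun j => if j < l then 0 else col_len lam j).

Definition scanning (n : nat) (lam : n.-tuple nat) (T : filling) : filling :=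
  fun l k =>
    value_at T (last (0, 0) (scan_path lam T (scan_cols lam T l k))).

Definition scan_cols_tail (n : nat) (lam : n.-tuple nat) (T : filling)
    (l k : nat) : nat -> nat :=
  fun j => if j == l then 0 else scan_cols lam T l k j.

(* The maximum of the column bottoms, with value 1 for the empty tableau. *)
Definition max_value (n : nat) (lam : n.-tuple nat) (T : filling)
    (c : nat -> nat) : nat :=
  if bottoms lam c is [::] then 1
  else \max_(b <- bottoms lam c) value_at T b.

Definition interval (p q : nat) : seq nat := index_iota p q.+1.

Definition setA (n : nat) (lam : n.-tuple nat) (T : filling)
    (pi : n.-tuple nat) (l k : nat) : seq nat :=
  if key lam pi l k < max_value lam T (scan_cols_tail lam T l k) then [::]
  else interval k (minn (key lam pi l k)
                     (minn (below_value lam T l k - 1)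
                           (right_value lam T l k))).

(* Main.v *)
(** The earliest weakly increasing subsequence of a sequence consists of its
    weak left-to-right maxima, so its last value is the maximum of the sequence.
    Hence S(T;l,k) = max(T(l,k), m(U)), and S(T;l,k) <= Y(l,k) splits into
    m(U) <= Y(l,k), the nonemptiness condition of A(T,pi;l,k), and
    T(l,k) <= Y(l,k).  The other bounds defining A(T,pi;l,k) hold for every
    semistandard T. *)

Require Import Defs.
From mathcomp Require Import all_boot.

(** The last value taken acts as a running maximum: a skipped entry lies strictly below it, and a
    taken entry replaces it. *)
Lemma last_ewis_from (A : Type) (f : A -> nat) (x : A) (s : seq A) :
  f (last x (ewis_from f (f x) s)) = maxn (f x) (\max_(b <- s) f b).
Proof.
elim: s x => [|y s IHs] x /=; first by rewrite big_nil maxn0.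
rewrite big_cons maxnA; case: leqP => [le_xy | /ltnW le_yx] /=.
  exact: IHs.
exact: IHs.
Qed.

(** In a weakly decreasing sequence the entries at least [j] form a prefix. This is conjugation of
    partitions, translating between row and column lengths. *)
Lemma ltn_count_sorted_geq (s : seq nat) (j i : nat) :
  sorted geq s -> 0 < j -> (i < count (leq j) s) = (j <= nth 0 s i).
Proof.
move=> + j_gt0; elim: s i => [|x s IHs] i /=.
  by rewrite nth_nil; case: j j_gt0.
move=> x_s; have geq_trans : transitive geq by move=> a b c ? /leq_trans; apply.
case: (leqP j x) => [le_jx | lt_xj].
  by case: i => [|i] /=; rewrite ?add1n ?le_jx // ltnS IHs ?(path_sorted x_s).
have le_s_x : all (geq x) s by apply: order_path_min x_s.
have count0 : count (leq j) s = 0.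
  apply/eqP; rewrite -leqn0 leqNgt -has_count; apply/hasPn => y /(allP le_s_x).
  by rewrite -ltnNge => /leq_ltn_trans; apply.
case: i => [|i] /=; first by rewrite count0 addn0 (leqNgt j) lt_xj.
by rewrite -IHs ?(path_sorted x_s) // count0.
Qed.

Section Scanning.

Variables (n : nat) (lam : n.-tuple nat) (T : filling).
Hypothesis hlam : partition_tuple lam.

Lemma in_shape_col_len (j i : nat) :
  in_shape lam j i = (0 < j) && (0 < i <= col_len lam j).
Proof.
rewrite /in_shape; case: i => [|i]; first by rewrite andbF.
case: j => [|j]; first by rewrite /= andbF.
rewrite /= /row_len /= -ltn_count_sorted_geq //; apply: andb_idl.
by move=> /leq_trans; apply; rewrite -[leqRHS](size_tuple lam) count_size.
Qed.

Lemma in_shape_row1 (j i : nat) : in_shape lam j i -> j <= row_len lam 1.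
Proof.
rewrite in_shape_col_len => /and3P[j_gt0 i_gt0 /(leq_trans i_gt0)].
by rewrite /col_len ltn_count_sorted_geq.
Qed.

(** Used with [l] the leftmost remaining column: it exhibits the head of the sequence being scanned,
    which every EWIS takes first. *)
Lemma bottoms_cons (c : nat -> nat) (l : nat) :
  0 < l <= row_len lam 1 -> 0 < c l -> (forall j, j < l -> c j = 0) ->
  bottoms lam c =
    (l, c l) :: bottoms lam (fun j => if j == l then 0 else c j).
Proof.
case/andP=> l_gt0 l_le cl_gt0 c_eq0; rewrite /bottoms.
have -> : row_len lam 1 = l.-1 + (row_len lam 1 - l).+1.
  by rewrite addnS -addSn prednK // subnKC.
rewrite iotaD add1n prednK //= !filter_cat /= eqxx cl_gt0 ltnn.
(* A general [d] serves both [c] and its variant with column [l] emptied. *)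
have nil_filter (d : nat -> nat) : (forall j, j < l -> d j = 0) ->
    [seq j <- iota 1 l.-1 | 0 < d j] = [::].
  move=> d_eq0; apply/eqP; rewrite -[_ == _]negbK -has_filter.
  apply/hasPn => j; rewrite mem_iota add1n prednK // => /andP[_ /d_eq0 ->].
  by [].
rewrite !nil_filter // => [|j lt_jl]; last by rewrite ltn_eqF ?c_eq0.
congr (_ :: _); set s := iota _ _.
have gt_s j : j \in s -> (j == l) = false.
  by rewrite mem_iota => /andP[/gtn_eqF].
have -> : [seq j <- s | 0 < (if j == l then 0 else c j)] =
          [seq j <- s | 0 < c j].
  by apply: eq_in_filter => j /gt_s ->.
by apply/eq_in_map => j; rewrite mem_filter => /andP[_ /gt_s ->].
Qed.

Lemma scan_cols_lt (l k j : nat) : j < l -> scan_cols lam T l k j = 0.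
Proof.
move=> lt_jl; rewrite /scan_cols.
elim: (_ - _) => [|m IHm] /=; first by rewrite lt_jl.
by rewrite /remove_path IHm; case: ifP.
Qed.

Lemma scan_colsS (l k : nat) : k < col_len lam l ->
  scan_cols lam T l k = remove_path lam T (scan_cols lam T l k.+1).
Proof. by move=> lt_k; rewrite /scan_cols subnS -iterS prednK // subn_gt0. Qed.

(* The column l is the leftmost one left, so each scanning path starts there
   and removes one box from it. *)
Lemma scan_cols_diag (l k : nat) :
  0 < l -> k <= col_len lam l -> scan_cols lam T l k l = k.
Proof.
(* The induction runs on the number of paths already removed, which is [col_len lam l - k]. *)
move=> l_gt0 le_k; rewrite -(subKn le_k).
have: col_len lam l - k <= col_len lam l by rewrite leq_subr.
elim: (_ - k) => [|m IHm] lt_m.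
  by rewrite subn0 /scan_cols subnn /= ltnn.
set q := col_len lam l - m.+1.
have Sq : q.+1 = col_len lam l - m by rewrite subnSK.
have lt_q : q < col_len lam l by rewrite Sq leq_subr.
have E : scan_cols lam T l q.+1 l = q.+1 by rewrite Sq IHm // ltnW.
have l_le : l <= row_len lam 1.
  by apply: (@in_shape_row1 l q.+1); rewrite in_shape_col_len l_gt0.
rewrite scan_colsS // /remove_path E /scan_path.
rewrite (@bottoms_cons _ l) ?l_gt0 ?E //.
  by rewrite mem_head.
by move=> j /scan_cols_lt.
Qed.

(** Splits the bottoms of $T^{(l,k)}$ into the box $(l,k)$ and the bottoms of $U^{(l,k)}$. *)
Lemma bottoms_scan_cols (l k : nat) : in_shape lam l k ->
  bottoms lam (scan_cols lam T l k) =
    (l, k) :: bottoms lam (scan_cols_tail lam T l k).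
Proof.
move=> lk; have l_le := in_shape_row1 _ _ lk.
move: lk; rewrite in_shape_col_len => /and3P[l_gt0 k_gt0 le_k].
rewrite (@bottoms_cons _ l) ?l_gt0 // => [||j /scan_cols_lt //];
  by rewrite scan_cols_diag.
Qed.

Lemma scanningE (l k : nat) : in_shape lam l k ->
  scanning lam T l k =
    maxn (T l k)
      (\max_(b <- bottoms lam (scan_cols_tail lam T l k)) value_at T b).
Proof.
move=> lk; rewrite /scanning /scan_path bottoms_scan_cols //=.
exact: last_ewis_from.
Qed.

Hypothesis hT : semistandard lam T.

Lemma scanning_max_value (l k : nat) : in_shape lam l k ->
  scanning lam T l k =
    maxn (T l k) (max_value lam T (scan_cols_tail lam T l k)).
Proof.
move=> lk; rewrite scanningE // /max_value; case: (bottoms _ _) => //.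
(* For empty $U$ the big maximum is 0 but [max_value] is 1; both are absorbed by [T l k], which is
   at least 1. *)
have [/andP[Tlk_gt0 _] _ _] := hT _ _ lk.
by rewrite big_nil maxn0; apply/esym/maxn_idPl.
Qed.

(** Column values start at 1 or more and increase strictly downwards; this gives the lower end of
    the interval. *)
Lemma semistandard_ge_row (l k : nat) : in_shape lam l k -> k <= T l k.
Proof.
elim: k => // -[_ lk | k IHk lSk]; first by have [/andP[]] := hT _ _ lk.
have lk : in_shape lam l k.+1.
  by move: lSk; rewrite !in_shape_col_len => /and3P[-> _ /ltnW].
by have [_ _ /(_ lSk)] := hT _ _ lk; apply: leq_ltn_trans; apply: IHk.
Qed.

Lemma semistandard_le_below (l k : nat) :
  in_shape lam l k -> T l k <= below_value lam T l k - 1.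
Proof.
move=> lk; rewrite /below_value; have [/andP[_ le_n] _ lt_below] := hT _ _ lk.
case: eqP => [_ | /eqP k_neq]; first by rewrite subn1.
have: T l k < T l k.+1.
  apply: lt_below; move: lk; rewrite !in_shape_col_len => /and3P[-> _ le_k].
  by rewrite [k < _]ltn_neqAle k_neq.
(* The value below exceeds [T l k], so it is positive and the truncated subtraction is exact. *)
by case: (T l k.+1) => // m; rewrite subn1.
Qed.

Lemma semistandard_le_right (l k : nat) :
  in_shape lam l k -> T l k <= right_value lam T l k.
Proof.
move=> lk; rewrite /right_value; have [/andP[_ le_n] le_right _] := hT _ _ lk.
case: eqP => [// | /eqP l_neq]; apply: le_right.
move: lk; rewrite /in_shape => /andP[-> /andP[_ le_l]].
by rewrite [l < _]ltn_neqAle l_neq.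
Qed.

(** The equivalence holds box by box. If $m(U)$ exceeds the key value, both sides are false;
    otherwise only the bound by the key value remains to be compared. *)
Lemma mem_setA (pi : n.-tuple nat) (l k : nat) : in_shape lam l k ->
  (T l k \in setA lam T pi l k) = (scanning lam T l k <= key lam pi l k).
Proof.
move=> lk; rewrite scanning_max_value // geq_max /setA.
case: (leqP (max_value _ _ _)); last by rewrite andbF.
rewrite /interval mem_index_iota ltnS !leq_min semistandard_ge_row //.
by rewrite semistandard_le_below // semistandard_le_right // !andbT.
Qed.

End Scanning.

Theorem theorem5p1 (n : nat) (hn : 1 <= n)
    (lam : n.-tuple nat) (hlam : partition_tuple lam)
    (pi : n.-tuple nat) (hpi : perm_tuple pi)
    (T : filling) (hT : semistandard lam T) :
  filling_le lam (scanning lam T) (key lam pi) <->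
  (forall l k : nat, in_shape lam l k -> T l k \in setA lam T pi l k).
Proof.
by split=> le_S l k lk; have := le_S l k lk; rewrite mem_setA.
Qed.
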